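(* Let $L$ be an oriented long link diagram with $k\ge 2$ numbered components $L_1,\dots,L_k$. Then $$lk(L_1,L_2)=\omega_{lk}\bigl(\varphi_1(L)\bigr),$$ where $\varphi_1$ is the subdiagram map to the space $\mathcal{LGD}_1$ of link Gauss diagrams with one arrow, and $\omega_{lk}:\mathcal{LGD}_1\to\mathbb{Q}$ is the linear map defined on the basis of one-arrow diagrams by: (i) a one-arrow diagram whose arrow joins the interval numbered $1$ to the interval numbered $2$ (in either direction) is sent to $\tfrac12$ if the arrow is positive and to $-\tfrac12$ if the arrow is negative; (ii) a one-arrow diagram whose arrow joins intervals numbered $n\neq m$ with $\{n,m\}\neq\{1,2\}$ is sent to $0$ (for either direction and either sign); (iii) a one-arrow diagram whose arrow has both endpoints on the same interval is sent to $0$ (for any number $n$ of the interval, either direction and either sign).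
   Context: An oriented long link diagram is a diagram of an oriented link with finitely many components, numbered by natural numbers $1,\dots,k$, such that each component has a marked starting point (on an arc of the diagram, away from crossings). The Gauss diagram of a long link diagram consists of one interval for each component, parameterizing that component from its starting point in the direction of its orientation and carrying the number of the component, together with one arrow for each crossing. The head of the arrow is at the parameter of the lower strand of the crossing and the tail is at the parameter of the upper strand, so arrows may have both endpoints on the same interval or on two different intervals. Each arrow carries the sign (positive or negative) of its crossing. Diagrams are considered up to orientation-preserving reparameterization of the intervals. A one-arrow subdiagram of a link Gauss diagram is obtained by choosing one arrow, removing all other arrows, deleting every interval having no endpoint of the chosen arrow, and reparameterizing the remaining interval(s), which keep their numbers. $\mathcal{LGD}_1$ is the $\mathbb{Q}$-vector space with basis all one-arrow link Gauss diagrams: for each natural number $n$, four diagrams with a single interval numbered $n$ and one signed arrow on it (two directions, two signs); and, for each pair of distinct natural numbers $n\ne m$, the diagrams with two intervals numbered $n$ and $m$ and one signed arrow from the interval $n$ to the interval $m$ or from $m$ to $n$. The map $\varphi_1$ sends a long link diagram to the sum in $\mathcal{LGD}_1$, over all arrows of its Gauss diagram, of the corresponding one-arrow subdiagrams. The linking number $lk(L_1,L_2)$ is one half of (the number of positive crossings between $L_1$ and $L_2$ minus the number of negative crossings between $L_1$ and $L_2$). *)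

(* Defs.v *)
From HB Require Import structures.
From mathcomp Require Import all_boot all_order all_algebra.
From mathcomp Require Import all_classical all_reals all_analysis.
From mathcomp Require Import freeg.

Set Implicit Arguments.
Unset Strict Implicit.
Unset Printing Implicit Defensive.

Import Order.TTheory GRing.Theory Num.Theory.
Import numFieldNormedType.Exports.

Local Open Scope classical_set_scope.
Local Open Scope ring_scope.

Definition det2 (R : realType) (u v : R * R) : R := u.1 * v.2 - u.2 * v.1.

(* A pair (i, t) is the point of parameter t on the i-th curve (or interval).
   Every curve is parameterized by [0, 1], with its marked starting point at
   the parameters 0 and 1.

   A diagram consists of closed plane curves whose only multiple points are
   finitely many transverse double points, with over/under information. No
   smoothness is required away from the crossings, so that both smooth and
   polygonal diagrams are covered. *)
Record long_link_diagram (R : realType) (k : nat) := LongLinkDiagram {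
  strand : 'I_k -> R -> R * R;
  strand_continuous : forall i, {within `[0, 1], continuous (strand i)};
  strand_closed : forall i, strand i 0 = strand i 1;

  crossing : finType;
  upper : crossing -> 'I_k * R;
  lower : crossing -> 'I_k * R;
  upper_in : forall c, 0 < (upper c).2 < 1;
  lower_in : forall c, 0 < (lower c).2 < 1;
  upper_inj : injective upper;
  lower_inj : injective lower;
  upper_neq_lower : forall c c', upper c <> lower c';
  crossing_double : forall c,
    strand (upper c).1 (upper c).2 = strand (lower c).1 (lower c).2;
  double_crossing : forall p q : 'I_k * R,
    0 <= p.2 < 1 -> 0 <= q.2 < 1 -> p <> q ->
    strand p.1 p.2 = strand q.1 q.2 ->
    exists c, (p = upper c /\ q = lower c) \/ (p = lower c /\ q = upper c);

  upper_derivable : forall c, derivable (strand (upper c).1) (upper c).2 1;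
  lower_derivable : forall c, derivable (strand (lower c).1) (lower c).2 1;
  crossing_transverse : forall c,
    det2 (derive1 (strand (upper c).1) (upper c).2)
         (derive1 (strand (lower c).1) (lower c).2) != 0
}.

(* The component of index i is the one numbered i.+1: L_1 has index 0. *)
Definition component_number (k : nat) (i : 'I_k) : nat := i.+1.

(* Right-hand rule: a crossing is positive when the frame (direction of the
   upper strand, direction of the lower strand) is positively oriented. *)
Definition crossing_positive (R : realType) (k : nat)
  (L : long_link_diagram R k) (c : crossing L) : bool :=
  0 < det2 (derive1 (strand L (upper c).1) (upper c).2)
           (derive1 (strand L (lower c).1) (lower c).2).

Definition crosses (R : realType) (k : nat) (L : long_link_diagram R k)
    (i j : 'I_k) (c : crossing L) : bool :=
  (((upper c).1 == i) && ((lower c).1 == j)) ||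
  (((upper c).1 == j) && ((lower c).1 == i)).

Definition lk (R : realType) (k : nat) (L : long_link_diagram R k)
    (i j : 'I_k) : rat :=
  (#|[pred c : crossing L | crosses i j c & crossing_positive c]|%:R -
   #|[pred c : crossing L | crosses i j c & ~~ crossing_positive c]|%:R) / 2.

Record gauss_diagram (R : realType) := GaussDiagram {
  gauss_interval : finType;
  interval_number : gauss_interval -> nat;
  interval_number_inj : injective interval_number;
  arrow : finType;
  arrow_tail : arrow -> gauss_interval * R;
  arrow_head : arrow -> gauss_interval * R;
  arrow_positive : arrow -> bool;
  arrow_tail_in : forall a, 0 < (arrow_tail a).2 < 1;
  arrow_head_in : forall a, 0 < (arrow_head a).2 < 1;
  arrow_tail_inj : injective arrow_tail;
  arrow_head_inj : injective arrow_head;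
  arrow_tail_neq_head : forall a b, arrow_tail a <> arrow_head b
}.

Lemma component_number_inj (k : nat) : injective (@component_number k).
Proof. by move=> i j [] /val_inj. Qed.

Definition gauss (R : realType) (k : nat) (L : long_link_diagram R k) :
    gauss_diagram R :=
  @GaussDiagram R 'I_k (@component_number k) (@component_number_inj k)
    (crossing L) (@upper R k L) (@lower R k L) (@crossing_positive R k L)
    (@upper_in R k L) (@lower_in R k L) (@upper_inj R k L) (@lower_inj R k L)
    (@upper_neq_lower R k L).

Section OneArrowSubdiagram.
Variables (R : realType) (G : gauss_diagram R) (a : arrow G).

Definition touched (i : gauss_interval G) : bool :=
  (i == (arrow_tail a).1) || (i == (arrow_head a).1).

Lemma tail_touched : touched (arrow_tail a).1.
Proof. by rewrite /touched eqxx. Qed.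

Lemma head_touched : touched (arrow_head a).1.
Proof. by rewrite /touched eqxx orbT. Qed.

Definition sub_number (i : {i : gauss_interval G | touched i}) : nat :=
  interval_number (val i).

Definition sub_tail (_ : unit) : {i : gauss_interval G | touched i} * R :=
  (exist (fun i => touched i) _ tail_touched, (arrow_tail a).2).

Definition sub_head (_ : unit) : {i : gauss_interval G | touched i} * R :=
  (exist (fun i => touched i) _ head_touched, (arrow_head a).2).

Lemma sub_number_inj : injective sub_number.
Proof. by move=> i j /interval_number_inj/val_inj. Qed.

Lemma sub_tail_in x : 0 < (sub_tail x).2 < 1.
Proof. exact: arrow_tail_in. Qed.

Lemma sub_head_in x : 0 < (sub_head x).2 < 1.
Proof. exact: arrow_head_in. Qed.

Lemma unit_fun_inj (T : Type) (f : unit -> T) : injective f.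
Proof. by move=> [] []. Qed.

Lemma sub_tail_neq_head x y : sub_tail x <> sub_head y.
Proof.
case=> ht h2; apply: (@arrow_tail_neq_head R G a a).
by rewrite [arrow_tail a]surjective_pairing ht h2 -surjective_pairing.
Qed.

Definition one_arrow_subdiagram : gauss_diagram R :=
  @GaussDiagram R {i : gauss_interval G | touched i} sub_number sub_number_inj
    unit sub_tail sub_head (fun=> arrow_positive a) sub_tail_in sub_head_in
    (@unit_fun_inj _ _) (@unit_fun_inj _ _) sub_tail_neq_head.

End OneArrowSubdiagram.

(* One-arrow link Gauss diagrams up to orientation-preserving
   reparameterization of the intervals:
   - OneInterval n d s has a single interval, numbered n, and an arrow of sign
     s on it, pointing in the direction of the interval iff d;
   - TwoIntervals p s has an arrow of sign s from the interval numbered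
     (val p).1 to the interval numbered (val p).2.
   The sign true is positive. *)
Inductive one_arrow_diagram :=
  | OneInterval of nat & bool & bool
  | TwoIntervals of {p : nat * nat | p.1 != p.2} & bool.

Definition one_arrow_code (d : one_arrow_diagram) :
    (nat * bool * bool) + ({p : nat * nat | p.1 != p.2} * bool) :=
  match d with
  | OneInterval n d s => inl (n, d, s)
  | TwoIntervals p s => inr (p, s)
  end.

Definition one_arrow_decode
    (x : (nat * bool * bool) + ({p : nat * nat | p.1 != p.2} * bool)) :=
  match x with
  | inl (n, d, s) => OneInterval n d s
  | inr (p, s) => TwoIntervals p s
  end.

Lemma one_arrow_codeK : cancel one_arrow_code one_arrow_decode.
Proof. by case. Qed.

HB.instance Definition _ :=
  Countable.copy one_arrow_diagram (can_type one_arrow_codeK).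

Notation LGD1 := {freeg one_arrow_diagram / rat}.

(* The reparameterization class of a Gauss diagram D with a as its only
   arrow. On a single interval the only invariant besides the number and the
   sign is which endpoint of the arrow comes first. *)
Definition one_arrow_class (R : realType) (D : gauss_diagram R)
    (a : arrow D) : one_arrow_diagram :=
  let n := interval_number (arrow_tail a).1 in
  let m := interval_number (arrow_head a).1 in
  if insub (n, m) is Some p then TwoIntervals p (arrow_positive a)
  else OneInterval n ((arrow_tail a).2 < (arrow_head a).2) (arrow_positive a).

Definition phi1 (R : realType) (k : nat) (L : long_link_diagram R k) : LGD1 :=
  \sum_(a : arrow (gauss L))
    << @one_arrow_class R (one_arrow_subdiagram a) tt >>.

Definition omega_lk_basis (d : one_arrow_diagram) : rat^o :=
  match d with
  | OneInterval _ _ _ => 0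
  | TwoIntervals p s =>
      if (val p == (1%N, 2%N)) || (val p == (2%N, 1%N))
      then (if s then 1 / 2 else - (1 / 2))
      else 0
  end.

Definition omega_lk : LGD1 -> rat^o := fglift omega_lk_basis.

Lemma omega_lk_is_linear : linear omega_lk.
Proof.
have omegaB : {morph omega_lk : x y / x - y}.
  exact: (@lift_is_additive rat one_arrow_diagram rat^o omega_lk_basis).
have omega0 : omega_lk 0 = 0 by rewrite -(subrr 0) omegaB subrr.
have omegaN : {morph omega_lk : x / - x}.
  by move=> x; rewrite -sub0r omegaB omega0 sub0r.
have omegaD : {morph omega_lk : x y / x + y}.
  by move=> x y; rewrite -{1}[y]opprK omegaB omegaN opprK.
have omegaU c d : omega_lk << c *g d >> = c *: omega_lk_basis d by exact: liftU.
have omega_sum (s : seq one_arrow_diagram) (F : one_arrow_diagram -> LGD1) :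
    omega_lk (\sum_(x <- s) F x) = \sum_(x <- s) omega_lk (F x).
  exact: (big_morph omega_lk omegaD omega0).
move=> c x y; rewrite omegaD; congr (_ + _).
have -> : omega_lk x = \sum_(d <- dom x) omega_lk << coeff d x *g d >>.
  by rewrite -omega_sum freeg_sumE.
rewrite scaler_sumr [c *: x]/(fgscale c x) omega_sum.
by apply: eq_bigr => d _; rewrite !omegaU scalerA.
Qed.

HB.instance Definition _ :=
  GRing.isLinear.Build rat LGD1 rat^o *:%R omega_lk omega_lk_is_linear.

(* Main.v *)
Require Import Defs.
From mathcomp Require Import all_boot all_order all_algebra.
From mathcomp Require Import all_classical all_reals all_analysis.
From mathcomp Require Import freeg.

Import GRing.Theory.
Local Open Scope ring_scope.

(** Both sides equal the sum of [1/2] times the sign over the crossings between the first two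
    components. By linearity, [omega_lk (phi1 L)] adds the weights of the one-arrow classes of all
    crossings, and only arrows joining intervals 1 and 2 have nonzero weight ([omega_lk_phi1]).
    Grouping the crossings by sign gives [lk] ([lk_sum]). *)

Lemma omega_lk_unit (d : one_arrow_diagram) :
  omega_lk << d >> = omega_lk_basis d.
Proof. by rewrite /omega_lk liftU scale1r. Qed.

(** The interval numbers and the sign alone determine the weight, so no case split on the
    constructor is needed afterwards. *)
Lemma omega_lk_one_arrow_class (R : realType) (D : gauss_diagram R)
    (a : arrow D) :
  let nm := (interval_number (arrow_tail a).1,
             interval_number (arrow_head a).1) in
  omega_lk_basis (one_arrow_class a) =
    if (nm == (1%N, 2%N)) || (nm == (2%N, 1%N))
    then (if arrow_positive a then 1 / 2 else - (1 / 2)) else 0.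
Proof.
rewrite /one_arrow_class /=; case: insubP => [p _ /= -> //|/=].
(* Both endpoints on one interval: a pair [(m, m)] is neither [(1, 2)] nor [(2, 1)]. *)
by rewrite negbK => /eqP ->; case: eqP => [[-> //]|_]; case: eqP => [[-> //]|].
Qed.

Lemma omega_lk_phi1 (R : realType) (k : nat) (L : long_link_diagram R k)
    (i j : 'I_k) : val i = 0%N -> val j = 1%N ->
  omega_lk (phi1 L) =
    \sum_(c : crossing L | crosses i j c)
      (if crossing_positive c then 1 / 2 else - (1 / 2)).
Proof.
move=> i0 j1; rewrite linear_sum [RHS]big_mkcond /=; apply: eq_bigr => c _.
rewrite omega_lk_unit omega_lk_one_arrow_class /= /sub_number
  /= /component_number.
(* Numbers are indices plus one, so [eqSS] turns 1 and 2 into the indices 0 and 1 of [i] and [j]. *)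
by rewrite /crosses !xpair_eqE !eqSS -!val_eqE /= i0 j1.
Qed.

Lemma lk_sum (R : realType) (k : nat) (L : long_link_diagram R k)
    (i j : 'I_k) :
  lk L i j = \sum_(c : crossing L | crosses i j c)
      (if crossing_positive c then 1 / 2 else - (1 / 2)).
Proof.
rewrite big_if /= !sumr_const /lk mulrBl div1r mulNrn !mulr_natl.
by congr (_ *+ _ - _ *+ _); apply: eq_card => c; rewrite !inE.
Qed.

Theorem theorem3p1 (R : realType) (k : nat) (hk : (2 <= k)%N)
    (L : long_link_diagram R k) :
  lk L (Ordinal (ltnW hk)) (Ordinal hk) = omega_lk (phi1 L).
Proof. by rewrite lk_sum; apply/esym/omega_lk_phi1. Qed.
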